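(* Let $m\ge 3$ and $1<c_2<c_3<\cdots<c_m<c_{m+1}$ be natural numbers, and let $\$_1=\langle 1,c_2,c_3\rangle$, $\$_2=\langle 1,c_2,\dots,c_m\rangle$ and $\$_3=\langle 1,c_2,\dots,c_m,c_{m+1}\rangle$ be three tight coin systems such that $\$_1$ is canonical but $\$_2$ is not. If $\$_3$ is non-canonical, then there are indices $2\le i\le j\le m$ such that $x=c_i+c_j$ satisfies $x>c_{m+1}$ and $x$ is a counterexample of $\$_3$.
   Context: A coin system is a tuple $\$=\langle c_1,\dots,c_m\rangle$ of natural numbers with $1=c_1<c_2<\cdots<c_m$. A representation of $x$ is a tuple $(\alpha_1,\dots,\alpha_m)$ of natural numbers with $\sum_i\alpha_ic_i=x$, of size $\sum_i\alpha_i$. The greedy representation $\mathrm{GRD}_{\$}(x)$ is the representation with $\sum_{j<i}\alpha_jc_j<c_i$ for all $2\le i\le m$; $\mathrm{OPT}_{\$}(x)$ is a representation of minimum size. A counterexample of $\$$ is a natural number $x$ with $|\mathrm{GRD}_{\$}(x)|>|\mathrm{OPT}_{\$}(x)|$; $\$$ is canonical if it has no counterexample and non-canonical otherwise. $\$$ is tight if it has no counterexample smaller than its largest coin $c_m$. *)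

(* Defs.v *)
From mathcomp Require Import all_boot.

Set Implicit Arguments.
Unset Strict Implicit.
Unset Printing Implicit Defensive.

Definition coin_system (m : nat) (s : m.-tuple nat) : bool :=
  (head 0 s == 1) && sorted ltn s.

Definition repr_value (m : nat) (s a : m.-tuple nat) : nat :=
  \sum_(i < m) tnth a i * tnth s i.

Definition repr_size (m : nat) (a : m.-tuple nat) : nat :=
  \sum_(i < m) tnth a i.

Definition is_repr (m : nat) (s : m.-tuple nat) (x : nat) (a : m.-tuple nat) :
    Prop :=
  repr_value s a = x.

(* Positions are numbered from 0 in a tuple, so [0 < i] selects all the coins
   but the first one, the coin 1. *)
Definition is_greedy (m : nat) (s : m.-tuple nat) (x : nat) (a : m.-tuple nat) :
    Prop :=
  is_repr s x a /\
  forall i : 'I_m, 0 < i ->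
    \sum_(j < m | j < i) tnth a j * tnth s j < tnth s i.

Definition is_optimal (m : nat) (s : m.-tuple nat) (x : nat)
    (a : m.-tuple nat) : Prop :=
  is_repr s x a /\
  forall b : m.-tuple nat, is_repr s x b -> repr_size a <= repr_size b.

(* By [greedy_exists], [greedy_unique], [optimal_exists] and
   [optimal_size_unique], in a coin system this compares two well-defined
   numbers, the size of the greedy representation and the minimum size. *)
Definition counterexample (m : nat) (s : m.-tuple nat) (x : nat) : Prop :=
  exists g o : m.-tuple nat,
    [/\ is_greedy s x g, is_optimal s x o & repr_size o < repr_size g].

Definition canonical (m : nat) (s : m.-tuple nat) : Prop :=
  forall x : nat, ~ counterexample s x.

Definition tight (m : nat) (s : m.-tuple nat) : Prop :=
  forall x : nat, x < last 0 s -> ~ counterexample s x.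

(* The tuple (c 1, ..., c k): the coins are numbered from 1. *)
Definition first_coins (c : nat -> nat) (k : nat) : k.-tuple nat :=
  [tuple c i.+1 | i < k].

Lemma coin_nth0 (m : nat) (s : m.-tuple nat) :
  coin_system s -> 0 < m /\ nth 0 s 0 = 1.
Proof.
move=> /andP[/eqP hs _]; rewrite -nth0 in hs; split=> //.
by case: m s hs => // s; rewrite tuple0.
Qed.

Lemma coin_gt0 (m : nat) (s : m.-tuple nat) (i : nat) :
  coin_system s -> i < m -> 0 < nth 0 s i.
Proof.
move=> hs im; have [m0 s0] := coin_nth0 hs; case/andP: hs => _ hs.
case: i im => [|i] im; first by rewrite s0.
apply: leq_ltn_trans (leq0n (nth 0 s 0)) _.
by apply: (sorted_ltn_nth ltn_trans) => //; rewrite inE size_tuple.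
Qed.

Lemma repr_valueE (m : nat) (s a : m.-tuple nat) :
  repr_value s a = \sum_(j < m) nth 0 a j * nth 0 s j.
Proof. by apply: eq_bigr => j _; rewrite !(tnth_nth 0). Qed.

Lemma partial_valueE (m : nat) (s a : m.-tuple nat) (i : 'I_m) :
  \sum_(j < m | j < i) tnth a j * tnth s j
    = \sum_(j < i) nth 0 a j * nth 0 s j.
Proof.
rewrite (big_ord_widen m (fun j => nth 0 a j * nth 0 s j)) 1?ltnW //.
by apply: eq_bigr => j _; rewrite !(tnth_nth 0).
Qed.

Lemma greedy_exists (m : nat) (s : m.-tuple nat) (x : nat) :
  coin_system s -> exists a, is_greedy s x a.
Proof.
move=> hs; have [m0 s0] := coin_nth0 hs; pose c := nth 0 s.
have key k y : k < m -> exists a : nat -> nat,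
    \sum_(j < k.+1) a j * c j = y /\
    forall i, 0 < i -> i <= k -> \sum_(j < i) a j * c j < c i.
  elim: k y => [|k IH] y km.
    by exists (fun=> y); rewrite big_ord1 /c s0 muln1; split=> // -[].
  have ck : 0 < c k.+1 by apply: coin_gt0.
  have [a [av ag]] := IH (y %% c k.+1) (ltnW km).
  exists (fun j => if j == k.+1 then y %/ c k.+1 else a j).
  have low i : i <= k.+1 ->
      \sum_(j < i) (if j == k.+1 :> nat then y %/ c k.+1 else a j) * c j
        = \sum_(j < i) a j * c j.
    move=> ik; apply: eq_bigr => j _.
    by rewrite ltn_eqF // (leq_trans (ltn_ord j) ik).
  split; first by rewrite big_ord_recr /= low // eqxx av addnC -divn_eq.
  move=> i i0; rewrite leq_eqVlt => /orP[/eqP-> | ik].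
    by rewrite low // av ltn_mod.
  by rewrite low; [exact: ag | exact: ltnW].
have m1 : m.-1 < m by rewrite prednK.
have [a [av ag]] := key m.-1 x m1; exists [tuple a i | i < m].
have na j : j < m -> nth 0 [tuple a i | i < m] j = a j.
  by move=> jm; rewrite -(tnth_nth 0 _ (Ordinal jm)) tnth_mktuple.
split=> [|i i0].
  rewrite /is_repr repr_valueE -av prednK //.
  by apply: eq_bigr => j _; rewrite na.
rewrite partial_valueE (tnth_nth 0).
under eq_bigr => j _ do rewrite na ?(ltn_trans (ltn_ord j)) //.
by apply: ag => //; rewrite -ltnS prednK.
Qed.

Lemma greedy_unique (m : nat) (s : m.-tuple nat) (x : nat) (a b : m.-tuple nat) :
  coin_system s -> is_greedy s x a -> is_greedy s x b -> a = b.
Proof.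
move=> hs [av ag] [bv bg]; have [m0 s0] := coin_nth0 hs.
pose S (t : m.-tuple nat) k := \sum_(j < k) nth 0 t j * nth 0 s j.
have lt t : is_greedy s x t -> forall k, k < m -> S t k < nth 0 s k.
  case=> _ tg [|k] km; first by rewrite /S big_ord0 s0.
  by have := tg (Ordinal km) isT; rewrite partial_valueE (tnth_nth 0).
have key k : k <= m -> S a k = S b k -> forall j, j < k -> nth 0 a j = nth 0 b j.
  elim: k => // k IH km; rewrite /S !big_ord_recr /= -!/(S _ k) => e.
  have ck := coin_gt0 hs km.
  have la : S a k < nth 0 s k by apply: lt.
  have lb : S b k < nth 0 s k by apply: lt.
  have ek : nth 0 a k = nth 0 b k.
    have := congr1 (divn ^~ (nth 0 s k)) e.
    by rewrite addnC [S b k + _]addnC !divnMDl //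
       !(divn_small la, divn_small lb) !addn0.
  move=> j; rewrite ltnS leq_eqVlt => /orP[/eqP-> // | jk].
  apply: IH => //; first exact: ltnW.
  by move: e; rewrite ek => /addIn.
apply: val_inj; apply: (@eq_from_nth _ 0); rewrite ?size_tuple // => j jm.
by apply: (key m) => //; rewrite /S -!repr_valueE av bv.
Qed.

Lemma optimal_exists (m : nat) (s : m.-tuple nat) (x : nat) :
  coin_system s -> exists a, is_optimal s x a.
Proof.
move=> hs.
pose up (t : m.-tuple 'I_x.+1) : m.-tuple nat := [tuple val (tnth t i) | i < m].
have lift b : is_repr s x b -> exists t, up t = b.
  move=> bv; exists [tuple inord (tnth b i) | i < m].
  apply: eq_from_tnth => i; rewrite !tnth_mktuple /= inordK // ltnS -bv.
  rewrite /repr_value (bigD1 i) //=; apply: leq_trans (leq_addr _ _).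
  by rewrite leq_pmulr // (tnth_nth 0) coin_gt0.
have [g [gv _]] := greedy_exists x hs; have [t0 t0g] := lift g gv.
pose P t := repr_value s (up t) == x.
have P0 : P t0 by rewrite /P t0g; apply/eqP.
case: (arg_minnP (fun t => repr_size (up t)) P0) => t /eqP tv tmin.
exists (up t); split=> // b bv; have [u ub] := lift b bv.
by rewrite -ub; apply: tmin; rewrite /P ub; apply/eqP.
Qed.

Lemma optimal_size_unique (m : nat) (s : m.-tuple nat) (x : nat)
    (a b : m.-tuple nat) :
  is_optimal s x a -> is_optimal s x b -> repr_size a = repr_size b.
Proof.
move=> [av amin] [bv bmin]; apply/eqP; rewrite eqn_leq.
by rewrite (amin _ bv) (bmin _ av).
Qed.

(* Main.v *)
Require Import Defs.
From mathcomp Require Import all_boot zify.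

(* Write M = c_(m+1).  The least counterexample w of the first m coins is at
   least M by tightness of the whole system, and it is less than 2 c_m, since
   removing any coin from an optimal representation of w leaves less than c_m.
   Hence M < 2 c_m.

   Suppose no two-coin sum is a counterexample, that is, c_i + c_j > M implies
   that c_i + c_j - M is a coin.  Let x >= M be the least counterexample of the
   whole system, let r = x - M, let c_k be the largest coin used by an optimal
   representation of x, and let b be another coin of it.  Maximality of k gives
   k <= m, x < c_(k+1) + b and b + c_k <= M, so that c_(k+1) - c_k > r.
   Exchange principle: if a coin e of this representation and a coin c_j with
   c_(j+1) - c_j > r satisfy e + c_j > M, then replacing e by e + c_j - M
   represents c_j + r < x with as many coins, so the greedy representations of
   c_j + r, and of M + r = x, have at most that many coins, a contradiction.
   If k = m, take e = c_j = c_m.  If k < m, take e = b and c_j = c_m to get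
   M - c_m <= r; but c_(k+1) + c_m - M is a coin smaller than c_(k+1), so
   c_(k+1) - c_k <= M - c_m <= r, a contradiction. *)

Set Implicit Arguments.
Unset Strict Implicit.
Unset Printing Implicit Defensive.

(** * Adding and removing a single coin *)

Definition add_coin (m : nat) (a : m.-tuple nat) (i : 'I_m) : m.-tuple nat :=
  [tuple tnth a j + (j == i) | j < m].

(** Comparing with every representation, not only an optimal one, lets this apply directly to
    representations obtained by exchanging coins. *)
Definition greedy_optimal (m : nat) (s : m.-tuple nat) (x : nat) : Prop :=
  forall g a : m.-tuple nat,
    is_greedy s x g -> is_repr s x a -> repr_size g <= repr_size a.

Lemma repr_value_add_coin (m : nat) (s a : m.-tuple nat) (i : 'I_m) :
  repr_value s (add_coin a i) = repr_value s a + tnth s i.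
Proof.
rewrite /repr_value; under eq_bigr => j _ do rewrite tnth_mktuple mulnDl.
rewrite big_split /=; congr (_ + _).
rewrite (bigD1 i) //= eqxx mul1n big1 ?addn0 // => j /negPf->.
by rewrite mul0n.
Qed.

Lemma repr_size_add_coin (m : nat) (a : m.-tuple nat) (i : 'I_m) :
  repr_size (add_coin a i) = (repr_size a).+1.
Proof.
rewrite /repr_size; under eq_bigr => j _ do rewrite tnth_mktuple.
rewrite big_split /= -addn1; congr (_ + _).
by rewrite (bigD1 i) //= eqxx big1 ?addn0 // => j /negPf->.
Qed.

Lemma add_coin_gt0 (m : nat) (a : m.-tuple nat) (i : 'I_m) :
  0 < tnth (add_coin a i) i.
Proof. by rewrite tnth_mktuple eqxx addn1. Qed.

Lemma add_coin_ex (m : nat) (a : m.-tuple nat) (i : 'I_m) :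
  0 < tnth a i -> exists b, a = add_coin b i.
Proof.
move=> ai; exists [tuple tnth a j - (j == i) | j < m].
apply: eq_from_tnth => j; rewrite !tnth_mktuple.
by case: eqP => [-> | _]; rewrite ?subn0 ?addn0 ?subnK.
Qed.

Lemma repr_size_gt0 (m : nat) (s a : m.-tuple nat) :
  0 < repr_value s a -> exists i, 0 < tnth a i.
Proof.
move=> v0; case: (pickP (fun i => 0 < tnth a i)) => [i ai | a0]; first by exists i.
move: v0; rewrite /repr_value big1 // => i _.
by move: (a0 i); rewrite lt0n => /negbFE/eqP->.
Qed.

Lemma coin_ltn (m : nat) (s : m.-tuple nat) (i j : 'I_m) :
  coin_system s -> i < j -> tnth s i < tnth s j.
Proof.
case/andP=> _ hs; rewrite !(tnth_nth 0).
by apply: (sorted_ltn_nth ltn_trans) => //; rewrite inE size_tuple.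
Qed.

Lemma coin_leq (m : nat) (s : m.-tuple nat) (i j : 'I_m) :
  coin_system s -> i <= j -> tnth s i <= tnth s j.
Proof.
move=> hs; rewrite leq_eqVlt => /orP[/eqP/val_inj-> // | /(coin_ltn hs)].
exact: ltnW.
Qed.

(** Discharges, for the largest coin, the conditions below on all later coins. *)
Lemma above_ord_max (m : nat) (P : 'I_m.+1 -> Prop) (l : 'I_m.+1) :
  (ord_max : 'I_m.+1) < l -> P l.
Proof. by move=> /leq_trans/(_ (leq_ord l)); rewrite ltnn. Qed.

Lemma top_coin (m : nat) (s : m.-tuple nat) (x : nat) (j : 'I_m) :
  tnth s j <= x ->
  exists k : 'I_m, [/\ j <= k, tnth s k <= x
    & forall l : 'I_m, k < l -> x < tnth s l].
Proof.
move=> jx.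
case: (arg_maxnP (fun k : 'I_m => k : nat) (P := fun k => tnth s k <= x) jx).
move=> k kx kmax; exists k; split=> // [|l kl]; first exact: kmax.
by rewrite ltnNge; apply/negP => /kmax /=; rewrite leqNgt kl.
Qed.

Lemma greedy_optimalP (m : nat) (s : m.-tuple nat) (x : nat) :
  coin_system s -> (greedy_optimal s x <-> ~ counterexample s x).
Proof.
move=> hs; split=> [gx [g [o [gg [ov _]]]] | ncx g a gg av].
  by rewrite ltnNge (gx g o).
case: leqP => // lt_ag; case: ncx.
have [o [ov omin]] := optimal_exists x hs; exists g, o; split=> //.
exact: leq_ltn_trans (omin _ av) lt_ag.
Qed.

Lemma greedy_optimal_intro (m : nat) (s : m.-tuple nat) (x : nat)
    (g o : m.-tuple nat) :
  coin_system s -> is_greedy s x g -> is_optimal s x o ->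
  repr_size g <= repr_size o -> greedy_optimal s x.
Proof.
move=> hs gg [_ omin] le_go g' a gg' /omin; rewrite -(greedy_unique hs gg gg').
exact: leq_trans.
Qed.

(** * Exchanging coins in greedy and optimal representations *)

(** Partial sums below coins up to [j] do not change; those below later coins are at most the total
    value, which is less than each later coin. *)
Lemma greedy_add_coin (m : nat) (s g : m.-tuple nat) (r : nat) (j : 'I_m) :
  coin_system s -> is_greedy s r g ->
  (forall l : 'I_m, j < l -> r + tnth s j < tnth s l) ->
  is_greedy s (r + tnth s j) (add_coin g j).
Proof.
move=> hs [gv gg] jtop.
have v : repr_value s (add_coin g j) = r + tnth s j.
  by rewrite repr_value_add_coin gv.
split=> // i i0; case: (ltnP j i) => ji.
  apply: leq_ltn_trans (jtop i ji).
  rewrite -v /repr_value [leqRHS](bigID (fun k : 'I_m => k < i)) /=.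
  exact: leq_addr.
apply: leq_ltn_trans (gg i i0); apply: eq_leq; apply: eq_bigr => k ki.
by rewrite tnth_mktuple -val_eqE /= ltn_eqF ?addn0 // (leq_trans ki).
Qed.

(** Take coin [i] away, represent the rest greedily, which uses its top coin [j] and costs no more,
    and put [i] back. *)
Lemma optimal_exchange (m : nat) (s a : m.-tuple nat) (x : nat) (i j : 'I_m) :
  coin_system s -> is_optimal s x a -> 0 < tnth a i -> tnth s i + tnth s j <= x ->
  greedy_optimal s (x - tnth s i) ->
  (forall l : 'I_m, j < l -> x - tnth s i < tnth s l) ->
  exists b, is_optimal s x b /\ 0 < tnth b j.
Proof.
move=> hs [av amin] /add_coin_ex[a' aE] ijx gx jtop; subst a.
move: av; rewrite /is_repr repr_value_add_coin => av.
have [g gg] := greedy_exists (x - tnth s i - tnth s j) hs.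
have rE : x - tnth s i - tnth s j + tnth s j = x - tnth s i by lia.
have gg' : is_greedy s (x - tnth s i) (add_coin g j).
  by rewrite -{1}rE; apply: greedy_add_coin => // l /jtop; rewrite rE.
have a'v : is_repr s (x - tnth s i) a' by rewrite /is_repr; lia.
have le_ga := gx _ _ gg' a'v.
exists (add_coin (add_coin g j) i); split; last first.
  by rewrite tnth_mktuple ltn_addr // add_coin_gt0.
split=> [|b /amin]; first by rewrite /is_repr repr_value_add_coin (proj1 gg'); lia.
by apply: leq_trans; rewrite 2!(repr_size_add_coin _ i) ltnS.
Qed.

Lemma optimal_top_coin (m : nat) (s a : m.-tuple nat) (x : nat) (j : 'I_m) :
  coin_system s -> is_optimal s x a -> 0 < tnth a j ->
  (forall l : 'I_m, j < l -> x < tnth s l) ->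
  greedy_optimal s (x - tnth s j) -> greedy_optimal s x.
Proof.
move=> hs ao /add_coin_ex[a' aE] jtop gx; subst a.
have := proj1 ao; rewrite /is_repr repr_value_add_coin => av.
have [g gg] := greedy_exists (x - tnth s j) hs.
have rE : x - tnth s j + tnth s j = x by lia.
have gg' : is_greedy s x (add_coin g j).
  by rewrite -{1}rE; apply: greedy_add_coin => // l /jtop; rewrite rE.
apply: greedy_optimal_intro gg' ao _ => //; rewrite !repr_size_add_coin ltnS.
by apply: gx => //; rewrite /is_repr; lia.
Qed.

(** The exchange principle: with [g] greedy for [r], the greedy representations of [r + tnth s k]
    and [r + tnth s j] are [g] plus one coin, so they have equal size; trading [i] for [l] in the
    optimal representation gives one of [r + tnth s j] of the same size. *)
Lemma greedy_optimal_transfer (m : nat) (s a : m.-tuple nat) (r : nat)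
    (i j k l : 'I_m) :
  coin_system s -> is_optimal s (r + tnth s k) (add_coin a i) ->
  tnth s k + tnth s l = tnth s i + tnth s j ->
  (forall n : 'I_m, k < n -> r + tnth s k < tnth s n) ->
  (forall n : 'I_m, j < n -> r + tnth s j < tnth s n) ->
  greedy_optimal s (r + tnth s j) -> greedy_optimal s (r + tnth s k).
Proof.
move=> hs ao klij ktop jtop gj.
have := proj1 ao; rewrite /is_repr repr_value_add_coin => av.
have [g gg] := greedy_exists r hs.
apply: greedy_optimal_intro (greedy_add_coin hs gg ktop) ao _ => //.
rewrite [leqRHS]repr_size_add_coin -(repr_size_add_coin _ l).
rewrite repr_size_add_coin -(repr_size_add_coin _ j).
apply: gj; first exact: greedy_add_coin.
rewrite /is_repr repr_value_add_coin; lia.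
Qed.

(** * Criteria for the absence of counterexamples *)

(** For [x >= M], removing any coin leaves at least the largest coin, so some optimal representation
    contains the largest coin, and induction applies after removing it. *)
Lemma least_counterexample_bound (m : nat) (s : m.+1.-tuple nat) (M : nat) :
  coin_system s -> tnth s ord_max <= M ->
  (forall x, x < M -> greedy_optimal s x) ->
  (tnth s ord_max).*2 <= M -> forall x, greedy_optimal s x.
Proof.
move=> hs lM gM M2; elim/ltn_ind => x IH.
case: (ltnP x M) => [/gM // | Mx].
have s0 : 0 < tnth s ord_max by rewrite (tnth_nth 0) coin_gt0.
have max_top y := @above_ord_max m (fun l => y < tnth s l).
have [o oo] := optimal_exists x hs.
have [i oi] : exists i, 0 < tnth o i.
  by apply: (@repr_size_gt0 _ s); rewrite (proj1 oo); lia.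
have si : tnth s i <= tnth s ord_max by rewrite coin_leq // -ltnS.
have si0 : 0 < tnth s i by rewrite (tnth_nth 0) coin_gt0.
have [|||b [bo bmax]] := optimal_exchange (j := ord_max) hs oo oi => //.
- lia.
- by apply: IH; lia.
- exact: max_top.
by apply: optimal_top_coin bo bmax _ _ => //; [exact: max_top | apply: IH; lia].
Qed.

(* [k] is the largest coin occurring in an optimal representation of [x]: the
   downward induction on [k] rules out every optimal representation. *)
Lemma two_coin_criterion (m : nat) (s : m.+1.-tuple nat) (p : 'I_m.+1) :
  coin_system s -> p.+1 = m ->
  (forall x, x < tnth s ord_max -> greedy_optimal s x) ->
  tnth s ord_max < (tnth s p).*2 ->
  (forall i j, tnth s ord_max < tnth s i + tnth s j ->
     exists k, tnth s ord_max + tnth s k = tnth s i + tnth s j) ->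
  forall x, greedy_optimal s x.
Proof.
set M := tnth s ord_max => hs pm gM M2 H; elim/ltn_ind => x IH.
case: (ltnP x M) => [/gM // | Mx].
have s0 (i : 'I_m.+1) : 0 < tnth s i by rewrite (tnth_nth 0) coin_gt0.
have max_top y := @above_ord_max m (fun l => y < tnth s l).
have M0 : 0 < M by apply: s0.
have rx : x - M + M = x by lia.
suff key n (k : 'I_m.+1) a : m - k <= n -> is_optimal s x a -> 0 < tnth a k ->
    greedy_optimal s x.
  have [o oo] := optimal_exists x hs.
  have [i oi] : exists i, 0 < tnth o i.
    by apply: (@repr_size_gt0 _ s); rewrite (proj1 oo); lia.
  exact: key (leqnn _) oo oi.
elim: n k a => [|n IHn] k a kn ao ak.
  have kE : k = ord_max by apply: val_inj => /=; have := ltn_ord k; lia.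
  subst k; apply: optimal_top_coin ao ak _ _ => //; first exact: max_top.
  by apply: IH; rewrite -/M; lia.
case: (ltnP k m) => [km | mk]; last by apply: (IHn k a) => //; lia.
pose k' := Ordinal (km : k.+1 < m.+1).
have IHk (j : 'I_m.+1) b : k < j -> is_optimal s x b -> 0 < tnth b j ->
    greedy_optimal s x by move=> kj; apply: IHn; lia.
have skM : tnth s k < M by apply: coin_ltn.
have [a' aE] := add_coin_ex ak; subst a.
have := proj1 ao; rewrite /is_repr repr_value_add_coin => av.
(* A second coin [i] exists because the coin [k] is less than [M <= x]. *)
have [|i ai] := @repr_size_gt0 _ s a'; first lia.
have [a'' aE] := add_coin_ex ai; subst a'.
move: av; rewrite repr_value_add_coin => av.
have aoi : 0 < tnth (add_coin (add_coin a'' i) k) i.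
  by rewrite tnth_mktuple ltn_addr.
(* If removing [i] leaves at least the coin [k'], an exchange brings in a coin beyond [k]. *)
case: (leqP (tnth s k' + tnth s i) x) => [le_x | lt_x].
  have [|j [kj jx jtop]] := @top_coin _ s (x - tnth s i) k'; first lia.
  have [||b [bo bj]] := optimal_exchange hs ao aoi _ _ jtop; first lia.
  - by apply: IH; have := s0 i; lia.
  - exact: (IHk j b).
(* If [i] and [k] together exceed [M], they can be replaced by the largest coin and [l]. *)
case: (leqP (tnth s i + tnth s k) M) => [le_M | /[dup] lt_M /H[l lE]]; last first.
  apply: (IHk ord_max (add_coin (add_coin a'' l) ord_max)) => //; last first.
    exact: add_coin_gt0.
  split=> [|b /(proj2 ao)]; rewrite ?/is_repr ?repr_value_add_coin -/M.
    by lia.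
  by rewrite !repr_size_add_coin.
have gap : x - M + tnth s k < tnth s k' by lia.
case: (ltnP k p) => [kp | pk]; last first.
  have kE : k = p by apply: val_inj => /=; lia.
  subst k; have [|l lE] := H p p; first lia.
  rewrite -rx; apply: (greedy_optimal_transfer (i := p) (j := p) (l := l)).
  - exact: hs.
  - by rewrite rx; exact: ao.
  - exact: lE.
  - exact: max_top.
  - by move=> q pq; apply: leq_trans gap _; apply: coin_leq.
  - by apply: IH; lia.
have sk'p : tnth s k' <= tnth s p by apply: coin_leq.
have spM : tnth s p < M by apply: coin_ltn => //=; lia.
case: (ltnP (x - M + tnth s p) M) => [lt_r | le_r].
  have [|l lE] := H i p; first lia.
  rewrite -rx; apply: (greedy_optimal_transfer (a := add_coin a'' k)
    (i := i) (j := p) (l := l)).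
  - exact: hs.
  (* The same coins, with [i] added last instead of [k]. *)
  - rewrite rx; split=> [|b /(proj2 ao)].
      by rewrite /is_repr !repr_value_add_coin; lia.
    by rewrite !repr_size_add_coin.
  - exact: lE.
  - exact: max_top.
  - move=> q pq; apply: leq_trans lt_r _; apply: coin_leq => //=.
    by move: pq; rewrite pm.
  - by apply: IH; lia.
(* Here [M - tnth s p <= x - M]. The coin [l] lies below [k'] by exactly [M - tnth s p], so the step
   from [k] to [k'] is at most [x - M], against [gap]. *)
have [|l lE] := H k' p; first by lia.
have lk : l <= k.
  rewrite leqNgt; apply/negP => kl.
  have : tnth s k' <= tnth s l by apply: coin_leq.
  lia.
have := coin_leq hs lk; lia.
Qed.

(** * Passing to the system without its largest coin *)

Lemma greedy_optimal_prefix (m : nat) (c : nat -> nat) (x : nat) :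
  x < c m.+1 -> greedy_optimal (first_coins c m.+1) x ->
  greedy_optimal (first_coins c m) x.
Proof.
move=> xm gx.
(* The default value 0 of [nth] is the multiplicity of the new coin. *)
pose ext (a : m.-tuple nat) : m.+1.-tuple nat := [tuple nth 0 a i | i < m.+1].
have extE a (i : 'I_m) : tnth (ext a) (widen_ord (leqnSn m) i) = tnth a i.
  by rewrite tnth_mktuple (tnth_nth 0).
have ext_max a : tnth (ext a) ord_max = 0.
  by rewrite tnth_mktuple nth_default ?size_tuple.
have ext_size a : repr_size (ext a) = repr_size a.
  rewrite /repr_size big_ord_recr /= ext_max addn0.
  by apply: eq_bigr => i _; rewrite extE.
have ext_value a :
    repr_value (first_coins c m.+1) (ext a) = repr_value (first_coins c m) a.
  rewrite /repr_value big_ord_recr /= ext_max mul0n addn0.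
  by apply: eq_bigr => i _; rewrite extE !tnth_mktuple.
move=> g a [gv gg] av; rewrite -!ext_size; apply: gx; last first.
  by rewrite /is_repr ext_value.
split=> [|i i0]; first by rewrite /is_repr ext_value.
rewrite big_mkcond big_ord_recr /= ext_max mul0n if_same addn0 -big_mkcond /=.
under eq_bigr => j _ do rewrite extE tnth_mktuple /=.
rewrite tnth_mktuple; case: (ltnP i m) => im.
  have := gg (Ordinal im) i0; rewrite tnth_mktuple /=.
  by under eq_bigr => j _ do rewrite tnth_mktuple.
(* At the new coin, the greedy condition follows from [x < c m.+1]. *)
have -> : i.+1 = m.+1 by have := ltn_ord i; lia.
apply: leq_ltn_trans xm; rewrite -gv /repr_value.
rewrite [leqRHS](bigID (fun j : 'I_m => j < i)) /=.
apply: leq_trans (leq_addr _ _); apply: eq_leq.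
by apply: eq_bigr => j _; rewrite tnth_mktuple.
Qed.

(** * Sums of two coins as counterexamples *)

Lemma repr_size_le1 (m : nat) (s a : m.-tuple nat) :
  0 < repr_value s a -> repr_size a <= 1 ->
  exists k, repr_value s a = tnth s k.
Proof.
move=> /repr_size_gt0[k /add_coin_ex[b ->]].
rewrite repr_size_add_coin ltnS leqn0 => /eqP b0; exists k.
rewrite repr_value_add_coin; suff -> : repr_value s b = 0 by [].
have [/repr_size_gt0[i /add_coin_ex[d bE]] | ] := ltnP 0 (repr_value s b).
  by move: b0; rewrite bE repr_size_add_coin.
by rewrite leqn0 => /eqP.
Qed.

(** The greedy representation takes the largest coin and leaves a positive remainder that is not a
    coin, so it needs at least three coins in all. *)
Lemma two_coin_counterexample (m : nat) (s : m.+1.-tuple nat) (i j : 'I_m.+1) :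
  coin_system s -> tnth s ord_max < tnth s i + tnth s j ->
  (forall k, tnth s ord_max + tnth s k != tnth s i + tnth s j) ->
  counterexample s (tnth s i + tnth s j).
Proof.
move=> hs lt_ij ne_ij.
have [g gg] := greedy_exists (tnth s i + tnth s j - tnth s ord_max) hs.
have [o oo] := optimal_exists (tnth s i + tnth s j) hs.
exists (add_coin g ord_max), o; split=> //.
  rewrite -{1}(subnK (ltnW lt_ij)); apply: greedy_add_coin => // l.
  exact: (@above_ord_max _ (fun l => _ < tnth s l)).
pose z : m.+1.-tuple nat := [tuple 0 | _ < m.+1].
have zv : repr_value s z = 0.
  by rewrite /repr_value big1 // => k _; rewrite tnth_mktuple.
have zs : repr_size z = 0.
  by rewrite /repr_size big1 // => k _; rewrite tnth_mktuple.
apply: (@leq_ltn_trans 2).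
  have := proj2 oo (add_coin (add_coin z i) j).
  by rewrite /is_repr !repr_value_add_coin !repr_size_add_coin zv zs => ->.
rewrite repr_size_add_coin ltnS ltnNge; apply/negP => g1.
have [|k] := repr_size_le1 (s := s) _ g1; rewrite (proj1 gg); first lia.
by move=> kE; have/eqP := ne_ij k; lia.
Qed.

Theorem theorem11 (m : nat) (c : nat -> nat)
    (hm : 3 <= m)
    (hsys1 : coin_system (first_coins c 3))
    (hsys2 : coin_system (first_coins c m))
    (hsys3 : coin_system (first_coins c m.+1))
    (htight1 : tight (first_coins c 3))
    (htight2 : tight (first_coins c m))
    (htight3 : tight (first_coins c m.+1))
    (hcan1 : canonical (first_coins c 3))
    (hncan2 : ~ canonical (first_coins c m))
    (hncan3 : ~ canonical (first_coins c m.+1)) :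
  exists i j : nat,
    [/\ 2 <= i, i <= j, j <= m, c m.+1 < c i + c j
      & counterexample (first_coins c m.+1) (c i + c j)].

Proof.
have coinE n (i : 'I_n) : tnth (first_coins c n) i = c i.+1 by rewrite tnth_mktuple.
set s := first_coins c m.+1 in hsys3 hncan3 htight3 *.
have lastE n : last 0 (first_coins c n.+1) = c n.+1.
  by rewrite (last_nth 0) size_tuple -(coinE _ ord_max) (tnth_nth 0).
(* From here on the two larger systems have [m.+1] and [m.+2] coins. *)
case: m => [//|m] in hm s hsys2 hsys3 htight2 htight3 hncan2 hncan3 *.
have g3 x : x < c m.+2 -> greedy_optimal s x.
  by move=> xm; apply/greedy_optimalP => //; apply: htight3; rewrite lastE.
have lt_m : c m.+1 < c m.+2.
  have mm : m < m.+2 by lia.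
  by have := @coin_ltn _ s (Ordinal mm) ord_max hsys3; rewrite !coinE => ->.
(* Otherwise the second system would be canonical, as it inherits from [g3] that no counterexample
   lies below [c m.+2]. *)
have M2 : c m.+2 < (c m.+1).*2.
  rewrite ltnNge; apply/negP => le2; apply: hncan2 => x.
  apply/greedy_optimalP => //.
  apply: (least_counterexample_bound (M := c m.+2)); rewrite ?coinE //.
    exact: ltnW.
  by move=> y ym; apply: greedy_optimal_prefix (g3 y ym).
pose bad (u : 'I_m.+2 * 'I_m.+2) :=
  (tnth s ord_max < tnth s u.1 + tnth s u.2) &&
  [forall k, tnth s ord_max + tnth s k != tnth s u.1 + tnth s u.2].
case: (pickP bad) => [[i j] /andP[/= lt_ij /forallP ne_ij] | nobad]; last first.
  case: hncan3 => x; apply/greedy_optimalP => //.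
  have mm : m < m.+2 by lia.
  apply: (two_coin_criterion (p := Ordinal mm)) => //; rewrite ?coinE // => i j.
  rewrite -[c _](coinE _ ord_max) -/s => lt_ij.
  have /negbT := nobad (i, j); rewrite /bad /= lt_ij negb_forall.
  by case/existsP=> k; rewrite negbK => /eqP kE; exists k.
have maxE : tnth s ord_max = c m.+2 by rewrite coinE.
wlog ij : i j lt_ij ne_ij / i <= j.
  move=> W; case: (leqP i j) => [|/ltnW] ij; first exact: (W i j).
  by apply: (W j i) => //; [rewrite addnC | move=> k; rewrite [eqbRHS]addnC].
have cij : counterexample s (tnth s i + tnth s j).
  exact: two_coin_counterexample.
(* If [j] were the largest coin, the excess over it would be the coin [i]. *)
have jm : j < m.+1.
  rewrite ltnNge; apply/negP => mj.
  have jE : j = ord_max by apply: val_inj => /=; have := ltn_ord j; lia.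
  by have := ne_ij i; rewrite jE addnC eqxx.
move: (lt_ij) (cij); rewrite maxE !coinE => lt_cij ccij.
exists i.+1, j.+1; split=> //.
(* The coin 1 plus a coin below the largest does not exceed the largest. *)
rewrite ltnS lt0n; apply/eqP => i0.
have s0 : tnth s i = 1 by rewrite (tnth_nth 0) i0; case: (coin_nth0 hsys3).
have := coin_ltn (j := ord_max) hsys3 jm; rewrite maxE; lia.
Qed.
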